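(* Let $B$ be a simple Bratteli diagram of finite rank with incidence matrices $\{F_n\}_{n\ge1}$. Suppose that there is a constant $c>0$ such that $m_n/M_n\ge c$ for all $n$, where $m_n$ and $M_n$ are the smallest and the largest entry of $F_n$, respectively. Then: (1) the diagram $B$ is of exact finite rank; (2) $h_w^{(n)}/h_v^{(n)}\ge c$ for all levels $n\geq 1$ and all vertices $v,w\in V_n$.
   Context: A Bratteli diagram $B=(V,E)$ is an infinite graph with vertex set $V=\bigsqcup_{i\ge 0}V_i$ and edge set $E=\bigsqcup_{i\ge 1}E_i$, all $V_i,E_i$ finite, $V_0=\{v_0\}$, with range and source maps $r(E_i)=V_i$, $s(E_i)=V_{i-1}$, $s^{-1}(v)\ne\emptyset$ for all $v$ and $r^{-1}(v)\ne\emptyset$ for $v\ne v_0$. $X_B$ is the space of infinite paths from $v_0$, topologized by cylinder sets. Incidence matrices: $F_n=(f^{(n)}_{v,w})_{v\in V_{n+1},w\in V_n}$, $f^{(n)}_{v,w}$ = number of edges between $w\in V_n$ and $v\in V_{n+1}$. For $v\in V_n$, $h_v^{(n)}$ is the number of finite paths from $v_0$ to $v$, and $X_v^{(n)}$ is the set of infinite paths from $v_0$ passing through $v$ at level $n$. $B$ is simple if for every $n$ there is $m>n$ such that every vertex of $V_n$ is connected to every vertex of $V_m$ by a path. Standing assumptions on finite rank diagrams: every level $V_n$, $n\ge1$, has the same number $d$ of vertices; there is exactly one edge from $v_0$ to each vertex of $V_1$ (so $h^{(n)}=F_{n-1}\cdots F_1(1,\dots,1)^T$); $X_B$ has no isolated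 points; the tail equivalence relation (paths agreeing from some level on) has no finite classes. An invariant measure is a non-atomic Borel measure on $X_B$ giving equal mass to the cylinder sets of any two finite paths from $v_0$ with the same range. A finite rank diagram is of exact finite rank if there are a finite invariant measure $\mu$ and a constant $\delta>0$ such that, after a telescoping (keeping a subsequence of levels and taking finite paths between consecutive kept levels as edges), $\mu(X_v^{(n)})\ge\delta$ for all levels $n\geq 1$ and all vertices $v$. *)

(* Defs.v *)
From HB Require Import structures.
From mathcomp Require Import all_boot all_order all_algebra.
From mathcomp Require Import all_classical all_reals all_analysis.
Set Implicit Arguments.
Unset Strict Implicit.
Unset Printing Implicit Defensive.
Import Order.TTheory GRing.Theory Num.Theory.
Local Open Scope classical_set_scope.

(* [edge G n] is the set of edges from level n to level n.+1, that is, the set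
   usually written E_{n+1}. *)
Record graded_graph := GradedGraph {
  vertex : nat -> finType;
  edge : nat -> finType;
  src : forall n, edge n -> vertex n;
  tgt : forall n, edge n -> vertex n.+1
}.
Arguments src {g n}.
Arguments tgt {g n}.

Record bratteli_diagram := BratteliDiagram {
  graph_of :> graded_graph;
  root_unique : #|vertex graph_of 0| = 1%N;
  src_surj : forall n (v : vertex graph_of n),
    exists e : edge graph_of n, src e = v;
  tgt_surj : forall n (v : vertex graph_of n.+1),
    exists e : edge graph_of n, tgt e = v
}.

(* The finite type of paths with n edges starting at level 0, bundled with the
   map giving the final vertex. *)
Fixpoint finpath_rec (G : graded_graph) (n : nat) :
    {T : finType & T -> vertex G n} :=
  match n with
  | 0 => existT (fun T : finType => T -> vertex G 0) (vertex G 0) id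
  | m.+1 =>
    let P := finpath_rec G m in
    existT (fun T : finType => T -> vertex G m.+1)
      {pe : projT1 P * edge G m | projT2 P pe.1 == src pe.2}
      (fun q => tgt (val q).2)
  end.

Definition finpath (G : graded_graph) (n : nat) : finType :=
  projT1 (finpath_rec G n).

Definition finpath_end (G : graded_graph) (n : nat) :
    finpath G n -> vertex G n :=
  projT2 (finpath_rec G n).

Fixpoint finpath_start (G : graded_graph) (n : nat) :
    finpath G n -> vertex G 0 :=
  match n with
  | 0 => id
  | m.+1 => fun p => @finpath_start G m (val p).1
  end.

Definition finpath_rcons (G : graded_graph) n (p : finpath G n) (e : edge G n)
    (pe : finpath_end p == src e) : finpath G n.+1 :=
  exist (fun q : finpath G n * edge G n => finpath_end q.1 == src q.2)
    (p, e) pe.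

Record infpath (G : graded_graph) := InfPath {
  step :> forall n, edge G n;
  step_linked : forall n, tgt (step n) = src (step n.+1)
}.

Lemma infpath_eq (G : graded_graph) (x y : infpath G) :
  (forall n, x n = y n) -> x = y.
Proof.
case: x y => x hx [y hy] /= xy.
have {}xy : x = y by apply: functional_extensionality_dep.
by subst y; rewrite (Prop_irrelevance hx hy).
Qed.

HB.instance Definition _ (G : graded_graph) := gen_eqMixin (infpath G).
HB.instance Definition _ (G : graded_graph) := gen_choiceMixin (infpath G).

Fixpoint iprefix_sig (G : graded_graph) (x : infpath G) (n : nat) :
    {p : finpath G n | finpath_end p = src (x n)} :=
  match n with
  | 0 =>
    exist (fun p : finpath G 0 => finpath_end p = src (x 0)) (src (x 0)) erefl
  | m.+1 =>
    let: exist p hp := iprefix_sig x m in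
    exist (fun p : finpath G m.+1 => finpath_end p = src (x m.+1))
      (finpath_rcons (introT eqP hp)) (step_linked x m)
  end.

Definition iprefix (G : graded_graph) (x : infpath G) n : finpath G n :=
  sval (iprefix_sig x n).

Lemma end_iprefix (G : graded_graph) (x : infpath G) n :
  finpath_end (iprefix x n) = src (x n).
Proof. exact: (svalP (iprefix_sig x n)). Qed.

Lemma iprefixS (G : graded_graph) (x : infpath G) n :
  val (iprefix x n.+1) = (iprefix x n, x n).
Proof. by rewrite /iprefix /=; case: (iprefix_sig x n). Qed.

Lemma start_iprefix (G : graded_graph) (x : infpath G) n :
  finpath_start (iprefix x n) = src (x 0).
Proof.
elim: n => // n IHn.
have -> : finpath_start (iprefix x n.+1) =
  finpath_start (val (iprefix x n.+1)).1 by [].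
by rewrite iprefixS.
Qed.

Lemma iprefix_le (G : graded_graph) (x y : infpath G) m n : (m <= n)%N ->
  iprefix x n = iprefix y n -> iprefix x m = iprefix y m.
Proof.
move=> /subnK <-; elim: (n - m)%N => // k IHk.
rewrite addSn => /(congr1 val); rewrite !iprefixS => -[xy _].
exact: IHk.
Qed.

Section PathSpace.
Variable B : bratteli_diagram.

Definition path_space := infpath B.

HB.instance Definition _ := Choice.on path_space.

Fact root_exists : exists v : vertex B 0, v \in predT.
Proof. by apply/card_gt0P; rewrite root_unique. Qed.

Definition root_vertex : vertex B 0 := xchoose root_exists.

Fact out_edge_exists n (v : vertex B n) : exists e : edge B n, src e == v.
Proof. by have [e <-] := src_surj v; exists e. Qed.

Fixpoint some_step (n : nat) : edge B n :=
  xchoose (out_edge_exists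
    (match n return vertex B n with
     | 0 => root_vertex
     | m.+1 => tgt (some_step m)
     end)).

Fact some_step_linked n : tgt (some_step n) = src (some_step n.+1).
Proof. by rewrite /= (eqP (xchooseP (out_edge_exists _))). Qed.

HB.instance Definition _ :=
  isPointed.Build path_space (InfPath some_step_linked).

Definition cylinder (n : nat) (p : finpath B n) : set path_space :=
  [set x | iprefix x n = p].

Definition finpath_total := {n : nat & finpath B n}.

HB.instance Definition _ := Choice.on finpath_total.
HB.instance Definition _ := isPointed.Build finpath_total
  (existT (fun n => finpath B n) 0 root_vertex).

Definition cylinder_base (p : finpath_total) : set path_space :=
  cylinder (projT2 p).

Fact cylinder_cover :
  \bigcup_(p in [set: finpath_total]) cylinder_base p = setT.
Proof.
apply/seteqP; split=> // x _.
by exists (existT (fun n => finpath B n) 0 (iprefix x 0)).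
Qed.

Fact cylinder_join (p q : finpath_total) (x : path_space) :
  [set: finpath_total] p -> [set: finpath_total] q ->
  cylinder_base p x -> cylinder_base q x ->
  exists r, [/\ [set: finpath_total] r, cylinder_base r x &
                cylinder_base r `<=` cylinder_base p `&` cylinder_base q].
Proof.
case: p q => [m p] [n q] _ _; rewrite /cylinder_base /cylinder /= => xp xq.
have [mn|/ltnW nm] := leqP m n.
  exists (existT (fun n => finpath B n) n q); split=> //= y yq; split=> //.
  by rewrite -xp; apply: (iprefix_le mn); rewrite xq.
exists (existT (fun n => finpath B n) m p); split=> //= y yp; split=> //.
by rewrite -xq; apply: (iprefix_le nm); rewrite xp.
Qed.

HB.instance Definition _ :=
  isBaseTopological.Build path_space cylinder_cover cylinder_join.

Definition borel_path_space := g_sigma_algebraType (@open path_space).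

HB.instance Definition _ := Measurable.on borel_path_space.

Definition paths_through (n : nat) (v : vertex B n) : set path_space :=
  [set x | src (x n) = v].

Definition tail_equiv (x y : path_space) : Prop :=
  exists N : nat, forall n, (N <= n)%N -> x n = y n.

(* The entry of F_n at row v, column w *)
Definition incidence (n : nat) (v : vertex B n.+1) (w : vertex B n) : nat :=
  #|[pred e : edge B n | (src e == w) && (tgt e == v)]|.

Definition max_entry (n : nat) : nat :=
  \max_(vw : vertex B n.+1 * vertex B n) incidence vw.1 vw.2.

(* The neutral element only serves to make sense of an empty minimum; since it
   bounds all entries and vertex sets are nonempty, it does not matter. *)
Definition min_entry (n : nat) : nat :=
  \big[minn/max_entry n]_(vw : vertex B n.+1 * vertex B n)
    incidence vw.1 vw.2.

Definition height (n : nat) (v : vertex B n) : nat :=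
  #|[pred p : finpath B n | finpath_end p == v]|.

End PathSpace.

(* The part of G above level m; [finpath (shift_graph G m) k] is the type of
   paths of G from level m to level k + m. *)
Definition shift_graph (G : graded_graph) (m : nat) : graded_graph :=
  GradedGraph (vertex := fun i => vertex G (i + m))
    (edge := fun i => edge G (i + m))
    (fun i (e : edge G (i + m)) => src e)
    (fun i (e : edge G (i + m)) => tgt e).

Definition simple_diagram (B : bratteli_diagram) : Prop :=
  forall n : nat, exists k : nat,
    forall (w : vertex B n) (v : vertex B (k.+1 + n)),
      exists p : finpath (shift_graph B n) k.+1,
        finpath_start p = w /\ finpath_end p = v.

Record finite_rank (B : bratteli_diagram) (d : nat) : Prop := FiniteRank {
  rank_level : forall n, (0 < n)%N -> #|vertex B n| = d;
  one_edge_from_root : forall v : vertex B 1,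
    #|[pred e : edge B 0 | tgt e == v]| = 1%N;
  no_isolated_path : isolated [set: path_space B] = set0;
  tail_classes_infinite : forall x : path_space B,
    infinite_set [set y | tail_equiv x y]
}.

Section Telescoping.
Variables (B : bratteli_diagram) (g : nat -> nat).

(* The kept levels 0 = t_0 < t_1 < ..., with consecutive differences
   t_{k+1} - t_k = (g k).+1 *)
Fixpoint kept_level (k : nat) : nat :=
  match k with
  | 0 => 0
  | j.+1 => (g j).+1 + kept_level j
  end.

Definition telescope_graph : graded_graph :=
  GradedGraph (vertex := fun k => vertex B (kept_level k))
    (edge := fun k => finpath (shift_graph B (kept_level k)) (g k).+1)
    (fun k p => finpath_start p)
    (fun k p => finpath_end p).

Fact telescope_root_unique : #|vertex telescope_graph 0| = 1%N.
Proof. exact: root_unique. Qed.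

Fact finpath_from m k (v : vertex B m) :
  exists p : finpath (shift_graph B m) k, finpath_start p = v.
Proof.
elim: k => [|k [p pv]]; first by exists v.
have [e ep] := src_surj (finpath_end p : vertex B (k + m)).
by exists (@finpath_rcons (shift_graph B m) k p e (introT eqP (esym ep))).
Qed.

Fact finpath_to m k (v : vertex B (k + m)) :
  exists p : finpath (shift_graph B m) k, finpath_end p = v.
Proof.
elim: k v => [|k IHk] v; first by exists v.
have [e ev] := tgt_surj (v : vertex B (k + m).+1).
have [p pe] := IHk (src e).
by exists (@finpath_rcons (shift_graph B m) k p e (introT eqP pe)).
Qed.

Fact telescope_src_surj k (v : vertex telescope_graph k) :
  exists e : edge telescope_graph k, src e = v.
Proof. exact: finpath_from. Qed.

Fact telescope_tgt_surj k (v : vertex telescope_graph k.+1) :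
  exists e : edge telescope_graph k, tgt e = v.
Proof. exact: finpath_to. Qed.

Definition telescoping : bratteli_diagram :=
  BratteliDiagram telescope_root_unique telescope_src_surj telescope_tgt_surj.

Definition shift_path (m : nat) (x : infpath B) : infpath (shift_graph B m) :=
  @InfPath (shift_graph B m) (fun i => x (i + m))
    (fun i => step_linked x (i + m)).

Definition telescope_step (x : infpath B) (k : nat) : edge telescoping k :=
  iprefix (shift_path (kept_level k) x) (g k).+1.

Fact telescope_step_linked x k :
  tgt (telescope_step x k) = src (telescope_step x k.+1).
Proof.
exact: etrans (end_iprefix (shift_path (kept_level k) x) (g k).+1)
  (esym (start_iprefix (shift_path (kept_level k.+1) x) (g k.+1).+1)).
Qed.

(* The canonical identification of the two path spaces *)
Definition telescope_path (x : path_space B) : path_space telescoping :=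
  InfPath (telescope_step_linked x).

End Telescoping.

Local Open Scope ring_scope.

Section Measures.
Variable R : realType.

Definition measure_atom (d : measure_display) (T : measurableType d)
    (mu : set T -> \bar R) (A : set T) : Prop :=
  [/\ measurable A, (0 < mu A)%E &
      forall C, measurable C -> C `<=` A -> mu C = 0%E \/ mu (A `\` C) = 0%E].

Definition nonatomic (d : measure_display) (T : measurableType d)
    (mu : set T -> \bar R) : Prop :=
  forall A, ~ measure_atom mu A.

Definition invariant_measure (B : bratteli_diagram)
    (mu : {measure set (borel_path_space B) -> \bar R}) : Prop :=
  nonatomic mu /\
  forall n (p q : finpath B n), finpath_end p = finpath_end q ->
    mu (cylinder p) = mu (cylinder q).

Definition exact_finite_rank (B : bratteli_diagram) : Prop :=
  exists (mu : {finite_measure set (borel_path_space B) -> \bar R})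
         (delta : R),
    [/\ invariant_measure mu, 0 < delta &
        exists g : nat -> nat,
          forall n (v : vertex (telescoping B g) n), (0 < n)%N ->
            (delta%:E <= mu (telescope_path g @^-1` paths_through v))%E].

End Measures.

(* Main.v *)
From HB Require Import structures.
Require Import Defs.
From mathcomp Require Import finmap.
From mathcomp Require Import all_boot all_order all_algebra.
From mathcomp Require Import all_classical all_reals all_analysis.
From mathcomp Require Import lra.

(* Each height at level n+1 is a combination of the heights at level n with
   coefficients from one row of F_n, so two heights at the same level are
   comparable up to the factor c. A function l on vertices with
   l(w) = sum of l over the targets of the edges leaving w gives the mass of the
   cylinders of an invariant measure; such an l is an ultrafilter limit, as N
   grows, of the proportion of the paths of length N that extend a given path.
   By the same comparison two weights at the same level are comparable up to c,
   and since the sum of h(v) l(v) over a level is 1, each X_v has mass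
   h(v) l(v) >= c^2 / d; hence no telescoping is needed. The measure is the
   image of Lebesgue measure on [0, 1[ under the coding of points by nested
   intervals of lengths l. An infinite tail class forces unbounded heights, so
   the masses of cylinders tend to 0 and there are no atoms. *)

Set Implicit Arguments.
Unset Strict Implicit.
Unset Printing Implicit Defensive.
Import Order.TTheory GRing.Theory Num.Theory.
Import numFieldNormedType.Exports.
Local Open Scope classical_set_scope.
Local Open Scope ring_scope.

(** * Heights and entries of the incidence matrices *)

Lemma min_entry_le (B : bratteli_diagram) n (v : vertex B n.+1)
    (w : vertex B n) : (min_entry B n <= incidence v w)%N.
Proof.
rewrite /min_entry; have := mem_index_enum (v, w).
elim: (index_enum _) => // u s IH; rewrite inE big_cons.
case/predU1P => [<-|/IH]; first exact: geq_minl.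
exact: leq_trans (geq_minr _ _).
Qed.

Lemma le_max_entry (B : bratteli_diagram) n (v : vertex B n.+1)
    (w : vertex B n) : (incidence v w <= max_entry B n)%N.
Proof. by apply: (leq_bigmax (F := fun vw => incidence vw.1 vw.2) (v, w)). Qed.

(** A path to [v] splits into an initial part and a last edge; the pairs are counted edge by
    edge. *)
Lemma heightS (B : bratteli_diagram) n (v : vertex B n.+1) :
  height v = (\sum_(e : edge B n | tgt e == v) height (src e))%N.
Proof.
transitivity (\sum_(pe : finpath B n * edge B n |
    (finpath_end pe.1 == src pe.2) && (tgt pe.2 == v)) 1)%N.
  rewrite sum1_card /height.
  rewrite -(card_imset [pred p : finpath B n.+1 | finpath_end p == v] val_inj).
  apply: eq_card => -[p e].
  apply/imsetP/idP => [[q qv ->]|/andP[/= pe ev]].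
    by apply/andP; split; [exact: (valP q)|exact: qv].
  by exists (finpath_rcons pe).
rewrite (eq_bigl (fun pe : finpath B n * edge B n =>
  predT pe.1 && ((finpath_end pe.1 == src pe.2) && (tgt pe.2 == v)))) //.
rewrite -(pair_big_dep _ (fun p e => (finpath_end p == src e) && (tgt e == v))
  (fun _ _ => 1%N)) (exchange_big_dep (fun e => tgt e == v)) /=; last first.
  by move=> p e _ /andP[].
apply: eq_bigr => e ev; rewrite sum1_card; apply: eq_card => p.
by rewrite unfold_in /= ev andbT.
Qed.

Lemma heightS_incidence (B : bratteli_diagram) n (v : vertex B n.+1) :
  height v = (\sum_(w : vertex B n) incidence v w * height w)%N.
Proof.
rewrite heightS (partition_big src predT) //=; apply: eq_bigr => w _.
rewrite (eq_bigr (fun=> height w)) => [|e /andP[_ /eqP->] //].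
rewrite sum_nat_const; congr (_ * _)%N; apply: eq_card => e.
by rewrite !inE andbC.
Qed.

Lemma height_gt0 (B : bratteli_diagram) n (v : vertex B n) : (0 < height v)%N.
Proof.
elim: n v => [|n IH] v; first by apply/card_gt0P; exists v; rewrite inE /=.
have [e ev] := tgt_surj v; rewrite heightS (bigD1 e) ?ev //=.
exact: leq_trans (IH _) (leq_addr _ _).
Qed.

Lemma height_level1 (B : bratteli_diagram) (v : vertex B 1) :
  #|[pred e : edge B 0 | tgt e == v]| = 1%N -> height v = 1%N.
Proof.
move=> ev1; rewrite heightS -[RHS]ev1 -sum1_card; apply: eq_bigr => e _.
apply/eqP; rewrite eqn_leq height_gt0 andbT.
by rewrite -(root_unique B); exact: max_card.
Qed.

Section EntryRatio.
Variables (R : realType) (B : bratteli_diagram) (c : R) (n : nat).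
Hypothesis c_gt0 : 0 < c.
Hypothesis c_le : c <= (min_entry B n)%:R / (max_entry B n)%:R.

Lemma max_entry_gt0 : 0 < (max_entry B n)%:R :> R.
Proof.
(* Division by zero gives 0, so a zero maximum would force [c <= 0]. *)
rewrite lt0r ler0n andbT; apply: contraTneq c_le => ->.
by rewrite invr0 mulr0 -ltNge.
Qed.

(** [c] times an entry is at most [c * M_n <= m_n], hence at most any other entry. *)
Lemma ratio_le_entry (v v' : vertex B n.+1) (w w' : vertex B n) :
  c * (incidence v w)%:R <= (incidence v' w')%:R.
Proof.
apply: (@le_trans _ _ (c * (max_entry B n)%:R)).
  by rewrite ler_pM2l // ler_nat le_max_entry.
apply: (@le_trans _ _ (min_entry B n)%:R); last by rewrite ler_nat min_entry_le.
by rewrite -ler_pdivlMr ?max_entry_gt0.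
Qed.

(** Both heights combine the same heights of level n, so two rows of F_n are compared term by
    term. *)
Lemma height_ratioS (v w : vertex B n.+1) :
  c * (height v)%:R <= (height w)%:R.
Proof.
rewrite !heightS_incidence !natr_sum mulr_sumr; apply: ler_sum => u _.
by rewrite !natrM mulrA ler_wpM2r // ratio_le_entry.
Qed.

End EntryRatio.

Lemma height_ratio (R : realType) (B : bratteli_diagram) (c : R) n
    (v w : vertex B n) :
  0 < c ->
  (forall u : vertex B 1, #|[pred e : edge B 0 | tgt e == u]| = 1%N) ->
  (forall n, (1 <= n)%N -> c <= (min_entry B n)%:R / (max_entry B n)%:R) ->
  (1 <= n)%N -> c * (height v)%:R <= (height w)%:R.
Proof.
move=> c0 h1 cr; case: n v w => // -[|n] v w _; last first.
  exact: height_ratioS (cr _ _) _ _.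
(* At level 1 all heights are 1, so [c <= 1] is left; it follows by comparing a nonzero entry of F_1
   with itself. *)
rewrite !height_level1 // mulr1; have [e _] := src_surj v.
have c1 := ratio_le_entry c0 (cr 1%N isT) (tgt e) (tgt e) (src e) (src e).
have : 0 < (incidence (tgt e) (src e))%:R :> R.
  by rewrite ltr0n; apply/card_gt0P; exists e; rewrite inE !eqxx.
by move=> i0; rewrite -(ler_pM2r i0) mul1r.
Qed.

(** * Limits along an ultrafilter *)

Lemma ultra_fmap (S T : Type) (f : S -> T) (F : set_system S) :
  UltraFilter F -> UltraFilter (f @ F).
Proof.
move=> FU; split=> [|G GF sFG]; first exact: fmap_proper_filter.
apply/seteqP; split=> // A GA.
have [//|FnA] := in_ultra_setVsetC (f @^-1` A) FU.
have GnA : G (~` A) by apply: sFG.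
by have /filter_ex[? []] : G (A `&` ~` A) by exact: filterI.
Qed.

(** The segment is compact and belongs to the image ultrafilter, which therefore converges in it. *)
Lemma ultra_cvg_segment (R : realType) (T : Type) (F : set_system T)
    (u : T -> R) (a b : R) :
  UltraFilter F -> (forall i, a <= u i <= b) ->
  exists x : R, a <= x <= b /\ u @ F --> x.
Proof.
move=> FU uab; have := @segment_compact R a b; rewrite compact_ultra.
have uF : (u @ F) `[a, b]%classic.
  by apply: (@filterS _ F _ setT) filterT => i _ /=; rewrite in_itv /= uab.
move=> /(_ _ (ultra_fmap u FU) uF)[x [/= xab ux]].
by exists x; split=> //; move: xab; rewrite in_itv.
Qed.

(** * Harmonic weights on vertices *)

Section Weights.
Variable B : bratteli_diagram.

(** The recursion is on the first edge, unlike that of [finpath], so that the counts obey the rule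
    [weight_split]. *)
Fixpoint npaths (k n : nat) : vertex B n -> nat :=
  if k is k'.+1 then
    fun w => (\sum_(e : edge B n | src e == w) npaths k' (tgt e))%N
  else fun=> 1%N.

Lemma npaths_gt0 k n (w : vertex B n) : (0 < npaths k w)%N.
Proof.
elim: k n w => // k IH n w; have [e ew] := src_surj w.
rewrite /= (bigD1 e) ?ew //=; exact: leq_trans (IH _ _) (leq_addr _ _).
Qed.

(** Prepending an edge into [w] lengthens each path by one, so counts do not decrease on the way
    back to level 0; where the truncated difference is 0, the count is 1. *)
Lemma npaths_le (N n : nat) (w : vertex B n) :
  (npaths (N - n) w <= \sum_(v : vertex B 0) npaths N v)%N.
Proof.
elim: n w => [|n IH] w; first by rewrite subn0 (bigD1 w) //= leq_addr.
have [e <-] := tgt_surj w; apply: leq_trans (IH (src e)).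
rewrite subnS; case: (N - n)%N => [|k]; first exact: npaths_gt0.
by rewrite /= (bigD1 e) //= leq_addr.
Qed.

Variable R : realType.

(** [l n v] stands for the mass of each cylinder ending at [v]: a cylinder is the disjoint union of
    its one-edge extensions, and the total mass is 1. *)
Record harmonic_weight (l : forall n, vertex B n -> R) : Prop :=
  HarmonicWeight {
  weight_ge0 : forall n (v : vertex B n), 0 <= l n v;
  weight_split : forall n (w : vertex B n),
    l n w = \sum_(e : edge B n | src e == w) l n.+1 (tgt e);
  weight_total : \sum_(v : vertex B 0) l 0%N v = 1
}.

Lemma harmonic_weight_exists : exists l, harmonic_weight l.
Proof.
(* An ultrafilter finer than [\oo] gives all bounded sequences a limit at once. *)
have [F [FU oF]] := @ultraFilterLemma nat \oo _.
pose tot N := (\sum_(v : vertex B 0) npaths N v)%N.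
have tot_gt0 N : 0 < (tot N)%:R :> R.
  have := npaths_le N (root_vertex B); rewrite subn0 ltr0n.
  exact: leq_trans (npaths_gt0 _ _).
(* For [N >= n], the share, among the paths of length [N] from the root, of those extending one
   fixed path to [w]. *)
pose a n (w : vertex B n) N : R := (npaths (N - n) w)%:R / (tot N)%:R.
have lim n (w : vertex B n) : exists x : R, 0 <= x <= 1 /\ a n w @ F --> x.
  apply: ultra_cvg_segment => N; rewrite divr_ge0 //=.
  by rewrite ler_pdivrMr // mul1r ler_nat npaths_le.
pose l n (w : vertex B n) := sval (cid (lim n w)).
have l01 n w : 0 <= l n w <= 1 by rewrite /l; case: cid => x [].
have al n w : a n w @ F --> l n w by rewrite /l; case: cid => x [].
exists l; split=> [n v|n w|]; first by have /andP[] := l01 n v.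
- apply: (@cvg_unique _ (@Rhausdorff R) (a n w @ F)); first exact: al.
  move=> /=.
  have : (fun N => \sum_(e : edge B n | src e == w) a n.+1 (tgt e) N) @ F -->
    \sum_(e : edge B n | src e == w) l n.+1 (tgt e).
    by apply: cvg_big => [|e _]; [exact: add_continuous|exact: al].
  apply: cvg_trans; apply: near_eq_cvg.
  (* Splitting off a first edge from paths of length [N - n] requires [N > n], which holds
     eventually and hence along [F]. *)
  apply: oF; exists n.+1 => // N /= nN; rewrite -mulr_suml -natr_sum /a.
  by have -> : (N - n)%N = (N - n.+1).+1 by rewrite -subSn // subSS.
- apply: (@cvg_unique _ (@Rhausdorff R) (cst 1 @ F)); last exact: cvg_cst.
  move=> /=; have : (fun N => \sum_(v : vertex B 0) a 0%N v N) @ F -->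
    \sum_(v : vertex B 0) l 0%N v.
    by apply: cvg_big => [|v _]; [exact: add_continuous|exact: al].
  apply: cvg_trans; apply: near_eq_cvg; apply: nearW => N.
  rewrite /= /a -mulr_suml -natr_sum subn0 divff //.
  exact: lt0r_neq0 (tot_gt0 N).
Qed.
End Weights.

(** * Tiling an interval by consecutive subintervals *)

Section PartialSums.
Variables (R : realDomainType) (I : eqType) (f : I -> R).
Hypothesis f_ge0 : forall i, 0 <= f i.
Implicit Type s : seq I.

(** With intervals of lengths [f j] placed end to end from 0 in the order of [s], this is the left
    end of the tile of [i]. *)
Definition sum_before s (i : I) : R := \sum_(j <- take (index i s) s) f j.

Lemma sum_before_ge0 s i : 0 <= sum_before s i.
Proof. exact: sumr_ge0. Qed.

Lemma sum_before_cons j s i :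
  sum_before (j :: s) i = if j == i then 0 else f j + sum_before s i.
Proof.
by rewrite /sum_before /=; case: eqP => _; rewrite ?big_nil ?big_cons.
Qed.

Lemma sum_before_le s i : i \in s -> sum_before s i + f i <= \sum_(j <- s) f j.
Proof.
elim: s => // j s IH; rewrite sum_before_cons big_cons inE eq_sym.
have [<- _|_ /= /IH] := eqP; first by rewrite add0r lerDl sumr_ge0.
by rewrite -addrA lerD2l.
Qed.

(** Either [y] lies in the first tile, or [y - f j] lies in the tiling by the others. *)
Lemma sum_before_exists s y : uniq s -> 0 <= y < \sum_(j <- s) f j ->
  exists2 i, i \in s & sum_before s i <= y < sum_before s i + f i.
Proof.
elim: s y => [|j s IH] y; first by rewrite big_nil; case: ltgtP.
rewrite big_cons => /andP[js us] /andP[y0 ys]; have [yj|jy] := ltP y (f j).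
  by exists j; rewrite ?mem_head // sum_before_cons eqxx add0r y0.
have [||i si iy] := IH (y - f j) => //; first by rewrite subr_ge0 jy ltrBlDl.
have ji : j != i by apply: contraNneq js => ->.
exists i; rewrite ?inE ?si ?orbT // sum_before_cons (negPf ji).
by move: iy; rewrite lerBrDl ltrBlDl addrA.
Qed.

Lemma sum_before_inj s y i k : i \in s -> k \in s ->
  sum_before s i <= y < sum_before s i + f i ->
  sum_before s k <= y < sum_before s k + f k -> i = k.
Proof.
elim: s y => // j s IH y; rewrite !sum_before_cons !inE ![_ == j]eq_sym.
have [<-|ji] /= := eqVneq j i; have [<-|jk] //= := eqVneq j k => si sk.
- rewrite add0r => /andP[_ yj] /andP[jy _].
  by have := le_lt_trans jy yj; rewrite gtrDl ltNge sum_before_ge0.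
- rewrite add0r => /andP[jy _] /andP[_ yj].
  by have := le_lt_trans jy yj; rewrite gtrDl ltNge sum_before_ge0.
- by rewrite -!addrA -!lerBrDl -![y < f j + _]ltrBlDl; exact: IH.
Qed.
End PartialSums.

(** * Finite paths and their last edges *)

Lemma level0_unique (B : bratteli_diagram) (v w : vertex B 0) : v = w.
Proof. by have /fintype_le1P := eq_leq (root_unique B); apply. Qed.

Section FinitePaths.
Variable G : graded_graph.

Definition finpath_init n (p : finpath G n.+1) : finpath G n := (val p).1.

Definition finpath_last n (p : finpath G n.+1) : edge G n := (val p).2.

Lemma finpath_endS n (p : finpath G n.+1) :
  finpath_end p = tgt (finpath_last p).
Proof. by []. Qed.

Lemma src_finpath_last n (p : finpath G n.+1) :
  src (finpath_last p) = finpath_end (finpath_init p).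
Proof. exact: (esym (eqP (valP p))). Qed.

Lemma finpath_eq n (p q : finpath G n.+1) :
  finpath_init p = finpath_init q -> finpath_last p = finpath_last q -> p = q.
Proof.
rewrite /finpath_init /finpath_last => pq1 pq2; apply: val_inj.
rewrite [LHS](surjective_pairing (val p)) [RHS](surjective_pairing (val q)).
by rewrite pq1 pq2.
Qed.

Lemma iprefix_init (x : infpath G) n :
  finpath_init (iprefix x n.+1) = iprefix x n.
Proof. by rewrite /finpath_init iprefixS. Qed.

Lemma iprefix_last (x : infpath G) n : finpath_last (iprefix x n.+1) = x n.
Proof. by rewrite /finpath_last iprefixS. Qed.
End FinitePaths.

(** * Coding points of the unit interval by infinite paths *)

Section PathMeasure.
Variables (R : realType) (B : bratteli_diagram) (l : forall n, vertex B n -> R).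
Hypothesis hl : harmonic_weight l.

Definition out_edges n (w : vertex B n) : seq (edge B n) :=
  enum [pred e | src e == w].

(** The position of the tile of [e] inside the interval of a path ending at [src e], relative to the
    left end. *)
Definition weight_before n (e : edge B n) : R :=
  sum_before (fun e' : edge B n => l (tgt e')) (out_edges (src e)) e.

Fixpoint offset (n : nat) : finpath B n -> R :=
  match n with
  | 0 => fun=> 0
  | m.+1 => fun p => @offset m (finpath_init p) + weight_before (finpath_last p)
  end.

(** Half-open, so that the intervals of the paths of one length partition [0, 1[ exactly; weight 0
    gives an empty interval. *)
Definition path_interval n (p : finpath B n) : set R :=
  `[offset p, offset p + l (finpath_end p)[%classic.

Lemma path_intervalE n (p : finpath B n) y :
  path_interval p y <-> offset p <= y < offset p + l (finpath_end p).
Proof. by rewrite /path_interval /= in_itv. Qed.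

Lemma sum_out_edges n (w : vertex B n) :
  \sum_(e <- out_edges w) l (tgt e) = l w.
Proof. by rewrite big_enum (weight_split hl). Qed.

Lemma mem_out_edges n (w : vertex B n) e : (e \in out_edges w) = (src e == w).
Proof. by rewrite mem_enum. Qed.

Lemma offsetS n (p : finpath B n.+1) :
  offset p = offset (finpath_init p) + weight_before (finpath_last p).
Proof. by []. Qed.

Lemma weight_level0 (v : vertex B 0) : l v = 1.
Proof.
rewrite -[RHS](weight_total hl) (bigD1 v) //= big_pred0 ?addr0 // => w.
by rewrite (level0_unique w v) eqxx.
Qed.

(** The tiles of the edges leaving [src e] have total length [l (src e)], so each stays inside the
    interval of the shorter path. *)
Lemma path_interval_init n (p : finpath B n.+1) y :
  path_interval p y -> path_interval (finpath_init p) y.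
Proof.
rewrite !path_intervalE offsetS finpath_endS -src_finpath_last.
move: (finpath_last p) (offset _) => e a /andP[ay ya].
have wb0 : 0 <= weight_before e.
  by apply: sum_before_ge0 => e'; exact: (weight_ge0 hl).
have : weight_before e + l (tgt e) <= l (src e).
  rewrite -(sum_out_edges (src e)).
  apply: sum_before_le => [e'|]; first exact: (weight_ge0 hl).
  by rewrite mem_out_edges.
rewrite -(lerD2l a) addrA => wbl.
by rewrite (le_trans _ ay) ?lerDl //= (lt_le_trans ya).
Qed.

Lemma path_interval_exists n y : `[0, 1[%classic y ->
  exists p : finpath B n, path_interval p y.
Proof.
rewrite /= in_itv /= => y01; elim: n => [|n [p py]].
  exists (root_vertex B); rewrite path_intervalE /= add0r.
  by rewrite weight_level0.
move: py; rewrite path_intervalE -(sum_out_edges (finpath_end p)) => py.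
have [] := @sum_before_exists _ _ (fun e => l (tgt e))
  (out_edges (finpath_end p)) (y - offset p).
- exact: enum_uniq.
- by rewrite subr_ge0 ltrBlDl.
move=> e; rewrite mem_out_edges => /eqP ep.
rewrite -ep lerBrDl ltrBlDl addrA => ey.
exists (@finpath_rcons _ _ p e (introT eqP (esym ep))).
by rewrite path_intervalE.
Qed.

(** By induction the initial parts agree; the last edges then leave the same vertex, and tiles of
    distinct edges are disjoint. *)
Lemma path_interval_inj n (p q : finpath B n) y :
  path_interval p y -> path_interval q y -> p = q.
Proof.
elim: n p q => [|n IH] p q; first by move=> _ _; exact: level0_unique.
move=> py qy.
have pq := IH _ _ (path_interval_init py) (path_interval_init qy).
apply: finpath_eq => //.
have sp := src_finpath_last p; have := src_finpath_last q; rewrite -pq -sp.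
move: py qy; rewrite !path_intervalE !offsetS !finpath_endS -pq.
move: (finpath_last p) (finpath_last q) (offset _) => e f a ey fy sfe.
move: ey fy; rewrite -!addrA -!lerBrDl -![y < a + (_ + _)]ltrBlDl.
rewrite /weight_before sfe; apply: sum_before_inj => [e'||].
- exact: (weight_ge0 hl).
- by rewrite mem_out_edges.
- by rewrite mem_out_edges sfe.
Qed.

Lemma path_in_intervals y : `[0, 1[%classic y ->
  exists x : path_space B, forall n, path_interval (iprefix x n) y.
Proof.
(* By uniqueness, the paths [P n] whose intervals contain [y] extend one another, so their last
   edges form an infinite path. *)
move=> y01; pose P n := sval (cid (path_interval_exists n y01)).
have Py n : path_interval (P n) y by rewrite /P; case: cid.
have initP n : finpath_init (P n.+1) = P n.
  exact: path_interval_inj (path_interval_init (Py n.+1)) (Py n).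
clearbody P.
have linked n : tgt (finpath_last (P n.+1)) = src (finpath_last (P n.+2)).
  by rewrite src_finpath_last initP finpath_endS.
pose x : path_space B := InfPath linked.
exists x => n; suff -> : iprefix x n = P n by [].
elim: n => [|n IH]; first exact: level0_unique.
by apply: finpath_eq; rewrite ?iprefix_init ?iprefix_last // initP.
Qed.

(** Made total by a constant value off [0, 1[, the set to which [path_measure] restricts Lebesgue
    measure. *)
Definition path_of (y : R) : borel_path_space B :=
  if pselect (`[0, 1[%classic y) is left y01
  then sval (cid (path_in_intervals y01)) else point.

Lemma path_of_interval y n : `[0, 1[%classic y ->
  path_interval (iprefix (path_of y) n) y.
Proof. by rewrite /path_of; case: pselect => // y01 _; case: cid. Qed.

Lemma path_interval_sub01 n (p : finpath B n) :
  path_interval p `<=` `[0, 1[%classic.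
Proof.
elim: n p => [|n IH] p; last first.
  by move=> y /path_interval_init; exact: IH.
by rewrite /path_interval add0r weight_level0.
Qed.

Lemma path_of_cylinder n (p : finpath B n) :
  path_of @^-1` cylinder p `&` `[0, 1[%classic = path_interval p.
Proof.
apply/seteqP; split=> [y [py y01]|y py].
  by have := path_of_interval n y01; rewrite [iprefix _ _]py.
have y01 := path_interval_sub01 py; split=> //.
exact: path_interval_inj (path_of_interval n y01) py.
Qed.

(** Indexing by all finite paths, a countable type, makes this a countable union, as measurability
    requires. *)
Lemma open_path_spaceE (A : set (path_space B)) : open A ->
  A = \bigcup_(p : finpath_total B)
        (if `[< cylinder_base p `<=` A >] then cylinder_base p else set0).
Proof.
move=> [D _ <-]; apply/seteqP; split=> [x [p Dp px]|x [p _]].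
  exists p => //; case: asboolP => //; by case=> z pz; exists p.
by case: asboolP => // pA; exact: pA.
Qed.

Lemma measurable_cylinder n (p : finpath B n) :
  measurable (cylinder p : set (borel_path_space B)).
Proof.
apply: sub_sigma_algebra; exists [set existT (fun n => finpath B n) n p] => //.
by rewrite bigcup_set1.
Qed.

Lemma measurable_path_of :
  measurable_fun [set: measurableTypeR R] (path_of : measurableTypeR R -> _).
Proof.
apply: (@measurability _ _ _ (borel_path_space B) setT path_of open) =>
  // _ [A oA <-].
rewrite setTI [A in path_of @^-1` A]open_path_spaceE // preimage_bigcup.
apply: countable_bigcupT_measurable => [|[n p]]; first exact: countableP.
case: ifP => _; last by rewrite preimage_set0.
have D01 : measurable (`[0, 1[%classic : set (measurableTypeR R)) by [].
(* Inside [0, 1[ the preimage of a cylinder is an interval; outside, where [path_of] is constant, it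
   is everything or nothing. *)
rewrite -[X in measurable X]setIT -(setUv `[0, 1[%classic) setIUr.
apply: measurableU; first by rewrite path_of_cylinder; exact: measurable_itv.
have [cp|cp] := pselect (cylinder p point).
  rewrite [X in measurable X](_ : _ = ~` `[0, 1[%classic).
    exact: measurableC.
  apply/seteqP; split=> [y []//|y y01]; split=> //.
  by rewrite /path_of /=; case: pselect.
rewrite [X in measurable X](_ : _ = set0) //.
apply/seteqP; split=> // y [+ y01].
by rewrite /path_of /=; case: pselect.
Qed.

Definition path_measure : set (borel_path_space B) -> \bar R :=
  pushforward (mrestr (@lebesgue_measure R) (measurable_itv `[0, 1[%R))
    (path_of : measurableTypeR R -> borel_path_space B).

Let path_measure0 : path_measure set0 = 0%E.
Proof. by rewrite /path_measure /pushforward preimage_set0 measure0. Qed.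

Let path_measure_ge0 A : (0 <= path_measure A)%E.
Proof. by have mf := measurable_path_of; exact: measure_ge0. Qed.

Let path_measure_sigma_additive : semi_sigma_additive path_measure.
Proof.
by have mf := measurable_path_of; exact: measure_semi_sigma_additive.
Qed.

HB.instance Definition _ := isMeasure.Build _ _ _ path_measure
  path_measure0 path_measure_ge0 path_measure_sigma_additive.

Lemma path_measure_cylinder n (p : finpath B n) :
  path_measure (cylinder p) = (l (finpath_end p))%:E.
Proof.
rewrite /path_measure /pushforward /mrestr path_of_cylinder.
rewrite lebesgue_measure_itv /= lte_fin ltrDl -EFinB addrAC subrr add0r.
(* The length formula separates nonempty from empty intervals; weight 0 is the empty case. *)
by case: ltgtP (weight_ge0 hl (finpath_end p)) => // <-.
Qed.

Let path_measure_fin_num : fin_num_fun path_measure.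
Proof.
apply: lty_fin_num_fun; rewrite /= /path_measure /pushforward /mrestr.
rewrite preimage_setT setTI.
by rewrite lebesgue_measure_itv /= lte01 ltry.
Qed.

HB.instance Definition _ := Measure_isFinite.Build _ _ _ path_measure
  path_measure_fin_num.
End PathMeasure.

(** * Masses of the sets X_v *)

Lemma measurable_paths_through (B : bratteli_diagram) n (v : vertex B n) :
  measurable (paths_through v : set (borel_path_space B)).
Proof.
rewrite [X in measurable X](_ : _ =
    \bigcup_(p in [set p | finpath_end p = v]) cylinder p).
  by apply: fin_bigcup_measurable => // p _; exact: measurable_cylinder.
apply/seteqP; split=> [x xv|x [p <- <-]]; last first.
  by rewrite /paths_through /= end_iprefix.
by exists (iprefix x n) => //=; rewrite end_iprefix.
Qed.

Lemma measure_split_cylinders (R : realType) (B : bratteli_diagram)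
    (mu : {measure set (borel_path_space B) -> \bar R})
    (A : set (borel_path_space B)) n : measurable A ->
  mu A = (\sum_(p : finpath B n) mu (A `&` cylinder p))%E.
Proof.
move=> mA; rewrite -big_enum [RHS]fsbig_seq ?enum_uniq //=.
rewrite -measure_fin_bigcup //.
- congr (mu _); apply/seteqP; split=> [x Ax|x [p _ []] //].
  by exists (iprefix x n) => //=; rewrite mem_enum.
- apply/trivIsetP => p q _ _ pq; apply/seteqP; split=> // x [[_ xp] [_ xq]].
  by move: pq; rewrite -xp -xq eqxx.
- by move=> p _; apply: measurableI => //; exact: measurable_cylinder.
Qed.

(** X_v is the disjoint union of the [height v] cylinders ending at [v], each of mass [l n v]. *)
Lemma measure_paths_through (R : realType) (B : bratteli_diagram)
    (l : forall n, vertex B n -> R) (hl : harmonic_weight l) n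
    (v : vertex B n) :
  path_measure hl (paths_through v) = ((height v)%:R * l n v)%:E.
Proof.
rewrite (measure_split_cylinders _ n); last exact: measurable_paths_through.
rewrite (bigID (fun p => finpath_end p == v)) /= [X in (_ + X)%E]big1 ?adde0.
  rewrite (eq_bigr (fun=> (l n v)%:E)) => [|p /eqP pv].
    by rewrite sumEFin sumr_const mulr_natl.
  rewrite setIidr ?path_measure_cylinder ?pv // => x xp.
  by rewrite /paths_through /= -end_iprefix [iprefix _ _]xp.
move=> p pv; rewrite [X in path_measure hl X](_ : _ = set0) ?measure0 //.
apply/seteqP; split=> // x [xv xp]; move: pv.
by rewrite -xp end_iprefix xv eqxx.
Qed.

Lemma sum_height_weight (R : realType) (B : bratteli_diagram)
    (l : forall n, vertex B n -> R) n : harmonic_weight l ->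
  \sum_(v : vertex B n) (height v)%:R * l n v = 1.
Proof.
move=> hl; elim: n => [|n IH].
  rewrite -[RHS](weight_total hl); apply: eq_bigr => v _.
  suff -> : height v = 1%N by rewrite mul1r.
  by rewrite -(card1 v); apply: eq_card => p; rewrite !inE.
rewrite -[RHS]IH.
(* Grouped by target, this sum over edges is the sum at level n+1; grouped by source, it is the one
   at level n. *)
transitivity (\sum_(e : edge B n) (height (src e))%:R * l n.+1 (tgt e)).
  rewrite (partition_big tgt predT) //=; apply: eq_bigr => v _.
  rewrite heightS natr_sum mulr_suml; apply: eq_bigr => e /eqP<- //.
rewrite (partition_big src predT) //=; apply: eq_bigr => w _.
rewrite (weight_split hl) mulr_sumr; apply: eq_bigr => e /eqP<- //.
Qed.

Lemma weight_incidence (R : realType) (B : bratteli_diagram)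
    (l : forall n, vertex B n -> R) n (w : vertex B n) : harmonic_weight l ->
  l n w = \sum_(v : vertex B n.+1) (incidence v w)%:R * l n.+1 v.
Proof.
move=> hl; rewrite (weight_split hl) (partition_big tgt predT) //=.
apply: eq_bigr => v _.
rewrite (eq_bigr (fun=> l n.+1 v)) => [|e /andP[_ /eqP->] //].
by rewrite sumr_const mulr_natl; congr (_ *+ _); apply: eq_card.
Qed.

(** Both weights combine the same weights of level n+1, so now two columns of F_n are compared. *)
Lemma weight_ratio (R : realType) (B : bratteli_diagram)
    (l : forall n, vertex B n -> R) (c : R) n (v w : vertex B n) :
  harmonic_weight l -> 0 < c ->
  c <= (min_entry B n)%:R / (max_entry B n)%:R -> c * l n v <= l n w.
Proof.
move=> hl c0 cr; rewrite !(weight_incidence _ hl) mulr_sumr.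
apply: ler_sum => u _; rewrite mulrA ler_wpM2r ?(weight_ge0 hl) //.
exact: ratio_le_entry.
Qed.

(** * Unbounded heights and absence of atoms *)

Lemma height_unbounded (B : bratteli_diagram) (x : path_space B) K :
  infinite_set [set y | tail_equiv x y] ->
  exists2 n, (0 < n)%N & (K <= height (src (x n)))%N.
Proof.
move=> /(infinite_set_fset K)[Y Yx KY].
have /choice[N xN] y : exists m : nat,
    tail_equiv x y -> forall n, (m <= n)%N -> x n = y n.
  by have [[m hm]|xy] := pselect (tail_equiv x y); [exists m|exists 0%N].
(* From level [M] on, which the successor makes positive, all paths in [Y] agree with [x]. Hence
   their prefixes of length [M] are distinct and all end at [src (x M)], whose height is thus at
   least [K]. *)
pose M := (\max_(y <- Y) N y).+1.
have xM y : y \in Y -> forall n, (M <= n)%N -> x n = y n.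
  move=> yY n Mn; apply: xN; first exact: Yx.
  apply: leq_trans (ltnW Mn); exact: leq_bigmax_seq.
exists M => //; apply: leq_trans KY _.
rewrite -(size_map (fun y : path_space B => iprefix y M)) /height cardE.
apply: uniq_leq_size => [|_ /mapP[y yY ->]]; last first.
  by rewrite mem_enum inE end_iprefix (xM y).
rewrite map_inj_in_uniq ?fset_uniq // => y z yY zY yz.
apply: infpath_eq => n; have [Mn|nM] := leqP M n; first by rewrite -!xM.
by have /(congr1 val) := iprefix_le nM yz; rewrite !iprefixS => -[].
Qed.

(** An atom has its whole mass in a single cylinder of level n; this is absurd once these cylinders
    have at most half that mass. *)
Lemma nonatomic_path_measure (R : realType) (B : bratteli_diagram)
    (l : forall n, vertex B n -> R) (hl : harmonic_weight l) :
  (forall e : R, 0 < e -> exists n, forall v : vertex B n, l n v <= e) ->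
  nonatomic (path_measure hl).
Proof.
move=> l_small A [mA A_gt0 Aatom].
have Afin : path_measure hl A \is a fin_num by exact: fin_num_measure.
have a_gt0 : 0 < fine (path_measure hl A) / 2.
  by rewrite divr_gt0 // fine_gt0 // A_gt0 ltey_eq Afin.
have [n ln] := l_small _ a_gt0.
have mAp p : measurable (A `&` cylinder p : set (borel_path_space B))%classic.
  by apply: measurableI => //; exact: measurable_cylinder.
have [Ap0|] := pselect (forall p : finpath B n,
    path_measure hl (A `&` cylinder p)%classic = 0%E).
  move: A_gt0; rewrite (measure_split_cylinders _ n) // big1 ?ltxx // => p _.
  exact: Ap0.
move=> /existsNP[p Ap]; have [//|ADp] := Aatom _ (mAp _ p) (@subIsetl _ _ _).
have : (path_measure hl A <= (l n (finpath_end p))%:E)%E.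
  rewrite -(path_measure_cylinder hl) (measureDI _ mA (mAp _ p)).
  rewrite [X in (X + _)%E]ADp add0e.
  rewrite setIA setIid; apply: le_measure; last exact: subIsetr.
    by rewrite inE; exact: mAp.
  by rewrite inE; exact: measurable_cylinder.
rewrite -(fineK Afin) lee_fin => /le_trans /(_ (ln _)).
by move: a_gt0; lra.
Qed.

Theorem proposition5p7 (R : realType) (B : bratteli_diagram) (d : nat) (c : R) :
  finite_rank B d ->
  simple_diagram B ->
  0 < c ->
  (forall n : nat, (1 <= n)%N ->
     c <= (min_entry B n)%:R / (max_entry B n)%:R) ->
  exact_finite_rank R B /\
  (forall (n : nat) (v w : vertex B n), (1 <= n)%N ->
     c <= (height w)%:R / (height v)%:R).
Proof.
move=> [card_d root_edge _ tail_inf] _ c0 cr.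
have h_ratio n (v w : vertex B n) :
    (1 <= n)%N -> c * (height v)%:R <= (height w)%:R by exact: height_ratio.
split; last first.
  by move=> n v w n1; rewrite ler_pdivlMr ?ltr0n ?height_gt0 ?h_ratio.
have [l hl] := harmonic_weight_exists B R.
have d_gt0 : 0 < d%:R :> R.
  rewrite ltr0n -(card_d 1%N) //; have [e _] := src_surj (root_vertex B).
  by apply/card_gt0P; exists (tgt e).
have l_ratio n (v w : vertex B n) : (1 <= n)%N -> c * l n v <= l n w.
  by move=> n1; exact: weight_ratio hl c0 (cr _ n1).
(* For each [u] of the level, c^2 h(u) l(u) <= h(v) l(v); summing over the [d] vertices, where the
   h(u) l(u) add up to 1, gives the bound. *)
have hl_ge n (v : vertex B n) :
    (1 <= n)%N -> c ^+ 2 / d%:R <= (height v)%:R * l n v.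
  move=> n1; rewrite ler_pdivrMr // -[leLHS]mulr1.
  rewrite -[X in _ * X <= _](sum_height_weight n hl).
  rewrite mulr_sumr -(card_d n) // mulr_natr -sumr_const; apply: ler_sum => u _.
  rewrite expr2 mulrACA ler_pM ?h_ratio ?l_ratio ?mulr_ge0 ?(ltW c0) //.
  exact: (weight_ge0 hl).
exists (path_measure hl : {finite_measure set _ -> \bar R}), (c ^+ 2 / d%:R).
split.
- split=> [|n p q pq]; last by rewrite /= !path_measure_cylinder pq.
  apply: nonatomic_path_measure => e e0.
  (* One height of at least 1/(c e) makes all heights of that level at least 1/e; since h(v) l(v) <=
     1, this gives l(v) <= e. *)
  have [n n0 hn] := height_unbounded (Num.bound (c * e)^-1) (tail_inf point).
  exists n => v.
  have hv : 1 <= (height v)%:R * e.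
    have ce_gt0 : 0 < c * e by rewrite mulr_gt0.
    have ceK := ltW (archi_boundP (ltW (_ : 0 < (c * e)^-1))).
    have K1 : 1 <= c * e * (height (src ((point : path_space B) n)))%:R.
      rewrite -ler_pdivrMl // mulr1 (le_trans (ceK _)) ?invr_gt0 // ler_nat.
      exact: hn.
    rewrite (le_trans K1) // mulrAC ler_pM2r //; exact: h_ratio.
  have hlv : (height v)%:R * l n v <= 1.
    rewrite -[leRHS](sum_height_weight n hl) (bigD1 v) //= lerDl sumr_ge0 //.
    move=> u _.
    by rewrite mulr_ge0 // (weight_ge0 hl).
  have hv0 : 0 < (height v)%:R :> R by rewrite ltr0n height_gt0.
  by rewrite -(ler_pM2l hv0) (le_trans hlv).
- by rewrite divr_gt0 ?exprn_gt0.
(* Consecutive kept levels differ by [(g j).+1], so the zero sequence keeps every level. *)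
exists (fun=> 0%N) => n v n0.
have -> : (telescope_path (fun=> 0%N) @^-1` paths_through v)%classic =
    paths_through (v : vertex B (kept_level (fun=> 0%N) n)).
  have src_telescope (x : path_space B) :
      src (telescope_path (fun=> 0%N) x n) = src (x (kept_level (fun=> 0%N) n)).
    exact: (start_iprefix (shift_path (kept_level (fun=> 0%N) n) x) 1).
  apply/seteqP; split=> x xv; first exact: etrans (esym (src_telescope x)) xv.
  exact: etrans (src_telescope x) xv.
rewrite [leRHS](measure_paths_through hl) lee_fin hl_ge //.
by case: n v n0.
Qed.
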